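(* Let $S$ be a finite set of alternatives, $V=\{1,\dots,N\}$ a finite set of voters, and $f:\Pi_S^V\to\Pi_S$ a social welfare function satisfying Independence of Irrelevant Alternatives. Then $f$ is clerical-dictatorial.
   Context: $\Pi_S$ denotes the set of complete transitive binary relations (weak preferences) on $S$; for $R\in\Pi_S$ we write $x\le_R y$ for $(x,y)\in R$, and $x<_R y$, $x=_R y$ have the obvious meanings. A configuration is ${\bf R}=(R_1,\dots,R_N)\in\Pi_S^V$. A social welfare function (SWF) is any map $f:\Pi_S^V\to\Pi_S$ (for any finite voter set $V$, possibly empty). Independence of Irrelevant Alternatives (IIA): whenever ${\bf P},{\bf Q}\in\Pi_S^V$ agree (for every voter) on the pair $\{x,y\}$, $f({\bf P})$ and $f({\bf Q})$ agree on $\{x,y\}$. $f$ is null if $x=_{f({\bf R})}y$ for all ${\bf R}$ and all $x,y$. $f$ is dictatorial with dictator $i$ if either for all $x,y,{\bf R}$: $x\le_{f({\bf R})}y\Rightarrow x\le_{R_i}y$, or for all $x,y,{\bf R}$: $x\le_{f({\bf R})}y\Rightarrow y\le_{R_i}x$. For ${\bf R}\in\Pi_S^V$, ${\bf R}_{-i}\in\Pi_S^{V\setminus\{i\}}$ is its restriction to voters other than $i$. A dictatorial $f$ with dictator $i$ defers to $g:\Pi_S^{V\setminus\{i\}}\to\Pi_S$ over $i$ if for all $x,y\in S$ and ${\bf R}$ with $x=_{R_i}y$: $x\le_{f({\bf R})}y\iff x\le_{g({\bf R}_{-i})}y$. $f$ is clerical with cleric $C\in\Pi_S$ if for all $x,y,{\bf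 R}$: $x\le_{f({\bf R})}y\Rightarrow x\le_C y$. For $A\subseteq S$, the restriction $f|_A:\Pi_A^V\to\Pi_A$ is defined by: given ${\bf R}\in\Pi_A^V$ pick any ${\bf R}'\in\Pi_S^V$ agreeing with ${\bf R}$ on all pairs in $A$, and set $x\le_{f|_A({\bf R})}y$ iff $x\le_{f({\bf R}')}y$ for $x,y\in A$; $f|_A$ is well defined if this does not depend on the choice of ${\bf R}'$. Clerical-dictatorial (recursive definition): $f:\Pi_S^V\to\Pi_S$ is clerical-dictatorial if it is null, or $|S|\le 2$, or there is a cleric $C\in\Pi_S$ such that (1) $f$ is clerical with cleric $C$, and (2) for every equivalence class $A$ of $C$: (a) $f|_A$ is well defined and is null, dictatorial, or $|A|=2$; (b) if $f|_A$ is dictatorial (with dictator $j$) then it defers over $j$ to a clerical-dictatorial function $\Pi_A^{V\setminus\{j\}}\to\Pi_A$. *)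

(* Defs.v *)
From HB Require Import structures.
From mathcomp Require Import all_boot.

Set Implicit Arguments.
Unset Strict Implicit.
Unset Printing Implicit Defensive.

Definition complete_rel (S : finType) (R : {set S * S}) : bool :=
  [forall x, forall y, ((x, y) \in R) || ((y, x) \in R)].

Definition transitive_rel (S : finType) (R : {set S * S}) : bool :=
  [forall x, forall y, forall z,
    ((x, y) \in R) ==> ((y, z) \in R) ==> ((x, z) \in R)].

(* Relations are finite sets of pairs, so that preferences (and profiles of
   preferences) are equal as soon as they have the same elements. *)
Record pref (S : finType) := Pref {
  pref_rel :> {set S * S};
  prefP : complete_rel pref_rel && transitive_rel pref_rel }.

HB.instance Definition _ (S : finType) := [isSub for @pref_rel S].
HB.instance Definition _ (S : finType) := [Finite of pref S by <:].

Definition leR (S : finType) (R : pref S) (x y : S) : bool := (x, y) \in pref_rel R.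
Definition eqR (S : finType) (R : pref S) (x y : S) : bool := leR R x y && leR R y x.

Definition profile (S V : finType) := {ffun V -> pref S}.

Definition swf (S V : finType) := profile S V -> pref S.

Section Preferences.
Variable S : finType.
Implicit Types (R : pref S) (r : rel S).

Lemma leR_total R : total (leR R).
Proof.
move=> x y; have /andP[/forallP/(_ x)/forallP/(_ y) cR _] := prefP R.
exact: cR.
Qed.

Lemma leR_trans R : transitive (leR R).
Proof.
move=> y x z; rewrite /leR => xy yz; have /andP[_] := prefP R.
by move=> /forallP/(_ x)/forallP/(_ y)/forallP/(_ z); rewrite xy yz.
Qed.

Lemma pref_of_subproof r : total r -> transitive r ->
  let R := [set p : S * S | r p.1 p.2] in complete_rel R && transitive_rel R.
Proof.
move=> tot tr /=; apply/andP; split.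
  by apply/forallP => x; apply/forallP => y; rewrite !inE; exact: tot.
apply/forallP => x; apply/forallP => y; apply/forallP => z; rewrite !inE /=.
by apply/implyP => xy; apply/implyP => yz; exact: tr xy yz.
Qed.

Definition pref_of r (tot : total r) (tr : transitive r) : pref S :=
  Pref (pref_of_subproof tot tr).

Lemma leR_pref_of r (tot : total r) (tr : transitive r) : leR (pref_of tot tr) =2 r.
Proof. by move=> x y; rewrite /leR inE. Qed.

End Preferences.

Section SocialWelfareFunctions.
Variables S V : finType.
Implicit Types (f : swf S V).

Definition agree_on_pair (P Q : pref S) (x y : S) : Prop :=
  leR P x y = leR Q x y /\ leR P y x = leR Q y x.

Definition IIA f : Prop :=
  forall (x y : S) (P Q : profile S V),
    (forall i, agree_on_pair (P i) (Q i) x y) -> agree_on_pair (f P) (f Q) x y.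

Definition null f : Prop :=
  forall (R : profile S V) (x y : S), eqR (f R) x y.

Definition dictator f (i : V) : Prop :=
  (forall (x y : S) (R : profile S V), leR (f R) x y -> leR (R i) x y) \/
  (forall (x y : S) (R : profile S V), leR (f R) x y -> leR (R i) y x).

Definition dictatorial f : Prop := exists i, dictator f i.

Definition clerical f (C : pref S) : Prop :=
  forall (x y : S) (R : profile S V), leR (f R) x y -> leR C x y.

Definition without (i : V) : finType := {k : V | k != i}.

Definition remove_voter (i : V) (R : profile S V) : profile S (without i) :=
  [ffun k => R (val k)].

(* Only meaningful together with [dictator f i]. *)
Definition defers f (i : V) (g : swf S (without i)) : Prop :=
  forall (x y : S) (R : profile S V), eqR (R i) x y ->
    (leR (f R) x y <-> leR (g (remove_voter i R)) x y).

End SocialWelfareFunctions.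

Definition alternatives (S : finType) (A : {set S}) : finType := {x : S | x \in A}.

Section Restriction.
Variables S V : finType.
Variable A : {set S}.
Implicit Types (R : profile (alternatives A) V) (f : swf S V).

Definition extends R (R' : profile S V) : Prop :=
  forall (i : V) (x y : alternatives A), leR (R' i) (val x) (val y) = leR (R i) x y.

Definition restriction_well_defined f : Prop :=
  forall R (R1 R2 : profile S V), extends R R1 -> extends R R2 ->
    forall x y : alternatives A,
      leR (f R1) (val x) (val y) = leR (f R2) (val x) (val y).

Lemma restrict_total (P : pref S) :
  total (fun x y : alternatives A => leR P (val x) (val y)).
Proof. by move=> x y; exact: leR_total. Qed.

Lemma restrict_trans (P : pref S) :
  transitive (fun x y : alternatives A => leR P (val x) (val y)).
Proof. by move=> y x z; exact: leR_trans. Qed.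

Definition restrict_pref (P : pref S) : pref (alternatives A) :=
  pref_of (restrict_total P) (@restrict_trans P).

(* The extension that ties all alternatives outside A and puts them after
   (i.e. above, for leR) those of A. *)
Definition extend_rel (P : pref (alternatives A)) (x y : S) : bool :=
  match insub x, insub y with
  | Some a, Some b => leR P a b
  | _, None => true
  | None, Some _ => false
  end.

Lemma extend_total P : total (extend_rel P).
Proof.
move=> x y; rewrite /extend_rel; case: (insub x) => [a|]; case: (insub y) => //= b.
exact: leR_total.
Qed.

Lemma extend_trans P : transitive (extend_rel P).
Proof.
move=> y x z; rewrite /extend_rel.
case: (insub x) => [a|]; case: (insub y) => [b|]; case: (insub z) => [c|] //.
exact: leR_trans.
Qed.

Definition extend_pref (P : pref (alternatives A)) : pref S :=
  pref_of (extend_total P) (@extend_trans P).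

Definition extend R : profile S V := [ffun i => extend_pref (R i)].

Lemma extendP R : extends R (extend R).
Proof. by move=> i x y; rewrite ffunE leR_pref_of /extend_rel !valK. Qed.

(* Computed with one particular extension of R; under
   restriction_well_defined any other one gives the same result (restrictP). *)
Definition restrict f : swf (alternatives A) V :=
  fun R => restrict_pref (f (extend R)).

Lemma restrictP f R (R' : profile S V) (x y : alternatives A) :
  restriction_well_defined f -> extends R R' ->
  leR (restrict f R) x y = leR (f R') (val x) (val y).
Proof.
move=> wd RR'; rewrite /restrict /restrict_pref leR_pref_of.
exact: wd (extendP R) RR' x y.
Qed.

End Restriction.

Arguments restriction_well_defined {S V} A f.
Arguments restrict {S V} A f.

Definition equiv_classes (S : finType) (C : pref S) : {set {set S}} :=
  equivalence_partition (eqR C) [set: S].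

(* The recursion terminates because voters are removed; reading it as a least
   fixed point is therefore the same as reading it as a recursion on #|V|. *)
Inductive clerical_dictatorial : forall S V : finType, swf S V -> Prop :=
| CD_null (S V : finType) (f : swf S V) :
    null f -> clerical_dictatorial f
| CD_small (S V : finType) (f : swf S V) :
    #|S| <= 2 -> clerical_dictatorial f
| CD_cleric (S V : finType) (f : swf S V) (C : pref S) :
    clerical f C ->
    (forall A, A \in equiv_classes C ->
       [/\ restriction_well_defined A f,
           [\/ null (restrict A f), dictatorial (restrict A f) | #|A| = 2] &
           forall j : V, dictator (restrict A f) j ->
             exists2 g : swf (alternatives A) (without j),
               defers (restrict A f) g & clerical_dictatorial g]) ->
    clerical_dictatorial f.

(* Main.v *)
Require Import Defs.
From mathcomp Require Import all_boot.

Set Implicit Arguments.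
Unset Strict Implicit.
Unset Printing Implicit Defensive.

(** The cleric ranks [x] below [y] when some profile makes [f] do so;
    transitivity holds because voters' opinions on [{x, y}] and on [{y, z}] can
    be prescribed independently.  On a class of the cleric no comparison is
    imposed, so Wilson's theorem applies there: with at least three
    alternatives, a nonnull [f] satisfies the Pareto condition or its reverse,
    and Arrow's theorem yields a dictator [j].  Where [j] is indifferent, [f]
    depends only on the other voters, through the function obtained by making
    [j] indifferent everywhere, and one concludes by induction on the number of
    voters. *)

(** * Preferences given by ranks *)

Section Ranks.
Variable S : finType.
Implicit Types (R : pref S) (x y z : S).

Definition ltR R x y : bool := ~~ leR R y x.

Lemma leR_refl R x : leR R x x.
Proof. by have := leR_total R x x; rewrite orbb. Qed.

Lemma ltRW R x y : ltR R x y -> leR R x y.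
Proof. by rewrite /ltR; case/orP: (leR_total R x y) => ->. Qed.

Lemma ltR_leR_trans R y x z : ltR R x y -> leR R y z -> ltR R x z.
Proof. by move=> xy yz; apply: contra xy; exact: leR_trans. Qed.

Lemma leR_ltR_trans R y x z : leR R x y -> ltR R y z -> ltR R x z.
Proof. by move=> xy yz; apply: contra yz => zx; exact: leR_trans zx xy. Qed.

Lemma agree_ltR (P Q : pref S) x y :
  agree_on_pair P Q x y -> (ltR P x y = ltR Q x y) * (ltR P y x = ltR Q y x).
Proof. by rewrite /ltR => -[-> ->]. Qed.

Lemma ltR_agree (P Q : pref S) x y :
  ltR P x y -> ltR Q x y -> agree_on_pair P Q x y.
Proof. by move=> Pxy Qxy; rewrite /agree_on_pair (ltRW Pxy) (ltRW Qxy) (negPf Pxy) (negPf Qxy). Qed.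

Definition rank_rel (h : S -> nat) : rel S := fun x y => h x <= h y.

Lemma rank_total h : total (rank_rel h).
Proof. by move=> x y; exact: leq_total. Qed.

Lemma rank_trans h : transitive (rank_rel h).
Proof. by move=> y x z; exact: leq_trans. Qed.

Definition rank_pref h : pref S := pref_of (rank_total h) (@rank_trans h).

Lemma leR_rank h x y : leR (rank_pref h) x y = (h x <= h y).
Proof. exact: leR_pref_of. Qed.

Definition rev_pref R : pref S :=
  @pref_of S (fun x y => leR R y x) (fun x y => leR_total R y x)
    (fun y x z xy yz => leR_trans yz xy).

Lemma leR_rev R x y : leR (rev_pref R) x y = leR R y x.
Proof. exact: leR_pref_of. Qed.

(* The rank of [x] relative to [y], where [y] itself has rank [1]. *)
Definition rel_rank R x y : nat :=
  if ltR R x y then 0 else if leR R x y then 1 else 2.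

Lemma rel_rank_le1 R x y : (rel_rank R x y <= 1) = leR R x y.
Proof.
by rewrite /rel_rank; case: ifP => [/ltRW -> //|_]; case: (leR R x y).
Qed.

Lemma rel_rank_ge1 R x y : (1 <= rel_rank R x y) = leR R y x.
Proof. by rewrite /rel_rank /ltR; case: (leR R y x); case: (leR R x y). Qed.

End Ranks.

(** * Profiles prescribed on three alternatives *)

Section ThreeRanks.
Variables S V : finType.
Variables x y z : S.
Hypotheses (xy : x != y) (yz : y != z) (xz : x != z).
Variables a b c : V -> nat.

Definition rank3 : profile S V :=
  [ffun i => rank_pref (fun s => if s == x then a i else if s == y then b i else c i)].

Lemma leR_rank3 i :
  ((leR (rank3 i) x y = (a i <= b i)) * (leR (rank3 i) y x = (b i <= a i))) *
  ((leR (rank3 i) y z = (b i <= c i)) * (leR (rank3 i) z y = (c i <= b i))) *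
  ((leR (rank3 i) x z = (a i <= c i)) * (leR (rank3 i) z x = (c i <= a i))).
Proof.
have [yx zx] : y != x /\ z != x by rewrite ![_ == x]eq_sym.
have zy : z != y by rewrite eq_sym.
by rewrite ffunE !leR_rank !eqxx (negPf yx) (negPf zx) (negPf zy).
Qed.

End ThreeRanks.

(** Pinning [y] at rank [1] lets relative ranks place [x] and [z] around it independently; the order
    of [x] and [z] is whatever results. *)
Lemma merge_profiles (S V : finType) (P Q : profile S V) (x y z : S) :
  x != y -> y != z -> x != z ->
  exists R : profile S V, (forall i, agree_on_pair (R i) (P i) x y) /\
    (forall i, agree_on_pair (R i) (Q i) y z).
Proof.
move=> xy yz xz.
exists (rank3 x y (fun i => rel_rank (P i) x y) (fun=> 1) (fun i => rel_rank (Q i) z y)).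
by split=> i; rewrite /agree_on_pair !(leR_rank3 xy yz xz) rel_rank_le1 rel_rank_ge1.
Qed.

Lemma merge_profiles_unanimous (S V : finType) (P : profile S V) (x y z : S) :
  x != y -> y != z -> x != z ->
  exists R : profile S V, [/\ forall i, agree_on_pair (R i) (P i) x y,
    forall i, ltR (R i) y z & forall i, ltR (R i) x z].
Proof.
move=> xy yz xz.
(* Relative ranks are at most [2], so rank [3] puts [z] strictly above both others. *)
exists (rank3 x y (fun i => rel_rank (P i) x y) (fun=> 1) (fun=> 3)).
split=> i; rewrite /agree_on_pair /ltR !(leR_rank3 xy yz xz) ?rel_rank_le1 ?rel_rank_ge1 //.
by rewrite /rel_rank; do 2?case: ifP.
Qed.

Lemma unanimous_merge_profiles (S V : finType) (P : profile S V) (x y z : S) :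
  x != y -> y != z -> x != z ->
  exists R : profile S V, [/\ forall i, agree_on_pair (R i) (P i) y z,
    forall i, ltR (R i) x y & forall i, ltR (R i) x z].
Proof.
move=> xy yz xz.
(* The successor keeps [z] strictly above [x], so the reference rank of [y] becomes [2]. *)
exists (rank3 x y (fun=> 0) (fun=> 2) (fun i => (rel_rank (P i) z y).+1)).
by split=> i; rewrite /agree_on_pair /ltR !(leR_rank3 xy yz xz) ?ltnS ?rel_rank_le1 ?rel_rank_ge1.
Qed.

(** * Wilson's theorem *)

Section Contagion.
Variable S : finType.
Hypothesis third : forall x y : S, exists2 z, x != z & y != z.

(** Ordered pairs are connected by replacing one entry at a time. A third alternative gives the
    reversal [(x, y)], [(x, z)], [(y, z)], [(y, x)], from which pairs ending in [x] are reached. *)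
Lemma contagion (P : S -> S -> Prop) :
  (forall x y z, x != y -> y != z -> x != z -> P x y -> P x z /\ P z y) ->
  forall x y, x != y -> P x y -> forall a b, a != b -> P a b.
Proof.
move=> spread x y xy Pxy.
have Pyx : P y x.
  have [z xz yz] := third x y.
  have yx : y != x by rewrite eq_sym.
  have zx : z != x by rewrite eq_sym.
  have zy : z != y by rewrite eq_sym.
  have [Pxz _] := spread x y z xy yz xz Pxy.
  have [_ Pyz] := spread x z y xz zy xy Pxz.
  by have [] := spread y z x yz zx yx Pyz.
move=> a b ab.
have [bx|bx] := eqVneq b x.
  subst b; have [-> //|ay] := eqVneq a y.
  have xa : x != a by rewrite eq_sym.
  have ya : y != a by rewrite eq_sym.
  have yx : y != x by rewrite eq_sym.
  by have [] := spread y x a yx xa ya Pyx.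
have xb : x != b by rewrite eq_sym.
have Pxb : P x b.
  have [-> //|yb] := eqVneq b y.
  rewrite eq_sym in yb.
  by have [] := spread x y b xy yb xb Pxy.
have [-> //|xa] := eqVneq a x.
rewrite eq_sym in xa; rewrite eq_sym in ab.
by have [] := spread x b a xb ab xa Pxb.
Qed.

End Contagion.

(** Weak rankings are what a class of the cleric provides; [strict_nonimposed] makes them strict. *)
Definition nonimposed (S V : finType) (f : swf S V) : Prop :=
  forall x y, exists R, leR (f R) x y.

Definition pareto (S V : finType) (f : swf S V) : Prop :=
  forall (x y : S) (R : profile S V), x != y ->
    (forall i, ltR (R i) x y) -> ltR (f R) x y.

(** * Arrow's theorem by decisive coalitions *)

Section Arrow.
Variables S V : finType.
Hypothesis third : forall x y : S, exists2 z, x != z & y != z.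
Variable f : swf S V.
Hypotheses (iia : IIA f) (par : pareto f).

Definition decisive (G : {set V}) (x y : S) : Prop :=
  forall R : profile S V, (forall i, i \in G -> ltR (R i) x y) -> ltR (f R) x y.

Definition opposed (G : {set V}) (x y : S) (R : profile S V) : Prop :=
  forall i, if i \in G then ltR (R i) x y else ltR (R i) y x.

(** In [P], coalition members rank [x < y < z]; the others put [y] below both [x] and [z], which
    they order as in [Q]. Then [f] ranks [x < y] as in [R] and [y < z] by Pareto, and IIA carries
    [x < z] over to [Q]. *)
Lemma decisive_spreadr G x y z R : x != y -> y != z -> x != z ->
  opposed G x y R -> ltR (f R) x y -> decisive G x z.
Proof.
move=> xy yz xz opp fxy Q GQ.
pose P : profile S V := rank3 x y (fun i => if i \in G then 0 else 2)
  (fun i => if i \in G then 1 else 0)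
  (fun i => if i \in G then 2 else (rel_rank (Q i) z x).+1).
have PR i : agree_on_pair (P i) (R i) x y.
  have := opp i; rewrite /agree_on_pair /ltR !(leR_rank3 xy yz xz).
  case: ifP => _ h; have h' := ltRW h; rewrite /ltR in h.
    by rewrite h' (negPf h).
  by rewrite h' (negPf h).
have PQ i : agree_on_pair (P i) (Q i) x z.
  rewrite /agree_on_pair !(leR_rank3 xy yz xz).
  case: ifP => [/GQ h|_]; last by rewrite ltnS rel_rank_ge1 ltnS rel_rank_le1.
  by rewrite (ltRW h) (negPf h).
rewrite -(agree_ltR (iia PQ)); apply: (ltR_leR_trans (y := y)).
  by rewrite (agree_ltR (iia PR)).
by apply/ltRW/par => // i; rewrite /ltR !(leR_rank3 xy yz xz); case: ifP.
Qed.

(** Mirror argument: members rank [z < x < y], and the others put [x] above both [y] and [z]. *)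
Lemma decisive_spreadl G x y z R : x != y -> y != z -> x != z ->
  opposed G x y R -> ltR (f R) x y -> decisive G z y.
Proof.
move=> xy yz xz opp fxy Q GQ.
pose P : profile S V := rank3 x y (fun i => if i \in G then 1 else 3)
  (fun i => if i \in G then 2 else 1)
  (fun i => if i \in G then 0 else rel_rank (Q i) z y).
have PR i : agree_on_pair (P i) (R i) x y.
  have := opp i; rewrite /agree_on_pair /ltR !(leR_rank3 xy yz xz).
  case: ifP => _ h; have h' := ltRW h; rewrite /ltR in h.
    by rewrite h' (negPf h).
  by rewrite h' (negPf h).
have PQ i : agree_on_pair (P i) (Q i) y z.
  rewrite /agree_on_pair !(leR_rank3 xy yz xz).
  case: ifP => [/GQ h|_]; last by rewrite rel_rank_le1 rel_rank_ge1.
  by rewrite (ltRW h) (negPf h).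
rewrite -(agree_ltR (iia PQ)); apply: (leR_ltR_trans (y := x)); last first.
  by rewrite (agree_ltR (iia PR)).
apply/ltRW/par => [|i]; first by rewrite eq_sym.
rewrite /ltR !(leR_rank3 xy yz xz); case: ifP => // _.
by rewrite /rel_rank; do 2?case: ifP.
Qed.

Lemma decisive_opposed G x y : x != y -> decisive G x y ->
  exists2 R, opposed G x y R & ltR (f R) x y.
Proof.
move=> xy dec; have [z xz yz] := third x y.
pose R : profile S V := rank3 x y (fun i => if i \in G then 0 else 1)
  (fun i => if i \in G then 1 else 0) (fun=> 0).
have opp : opposed G x y R.
  by move=> i; rewrite /ltR !(leR_rank3 xy yz xz); case: (i \in G).
exists R => //; apply: dec => i Gi; have := opp i.
by rewrite Gi.
Qed.

(** A single win against full opposition makes a pair decisive, and a decisive pair yields such a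
    win again, so decisiveness is contagious. *)
Lemma opposed_decisive G x y R : x != y -> opposed G x y R -> ltR (f R) x y ->
  forall a b, a != b -> decisive G a b.
Proof.
move=> xy opp fxy; have [z xz yz] := third x y.
have dec := decisive_spreadr xy yz xz opp fxy.
apply: (contagion third _ xz dec) => u v w uv vw uw duv.
have [Q oppQ fQ] := decisive_opposed uv duv.
by split; [exact: decisive_spreadr oppQ fQ | exact: decisive_spreadl oppQ fQ].
Qed.

(* Splitting a decisive coalition along a Condorcet profile. *)
Lemma decisive_split (G : {set V}) j : j \in G -> (forall a b, a != b -> decisive G a b) ->
  (forall a b, a != b -> decisive [set j] a b) \/
  (forall a b, a != b -> decisive (G :\ j) a b).
Proof.
move=> Gj dec.
have [[x y]/= xy|none] := pickP (fun p : S * S => p.1 != p.2); last first.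
  by left=> a b; have /= -> := none (a, b).
have [z xz yz] := third x y.
pose R : profile S V := rank3 x y
  (fun i => if i == j then 0 else if i \in G then 1 else 2)
  (fun i => if i == j then 1 else if i \in G then 2 else 0)
  (fun i => if i == j then 2 else if i \in G then 0 else 1).
have fxy : ltR (f R) x y.
  apply: dec => // i Gi; rewrite /ltR !(leR_rank3 xy yz xz) Gi.
  by case: ifP.
(* Only [j] ranks [x] below [z]. Otherwise [f] has [z <= x < y], and only [G :\ j] ranks [z] below
   [y]. *)
have [fxz|fzx] := boolP (ltR (f R) x z); [left|right].
  apply: (opposed_decisive xz _ fxz) => i.
  rewrite inE /ltR !(leR_rank3 xy yz xz).
  by case: (i == j); case: (i \in G).
rewrite negbK in fzx.
have zy : z != y by rewrite eq_sym.
apply: (opposed_decisive zy _ (leR_ltR_trans fzx fxy)) => i.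
rewrite !inE /ltR !(leR_rank3 xy yz xz).
by case: (i == j); case: (i \in G).
Qed.

Lemma arrow (x0 : S) :
  exists j, forall x y (R : profile S V), leR (f R) x y -> leR (R j) x y.
Proof.
have [z0 xz0 _] := third x0 x0.
have shrink n (G : {set V}) : #|G| <= n -> (forall a b, a != b -> decisive G a b) ->
    exists j, forall a b, a != b -> decisive [set j] a b.
  elim: n G => [|n IHn] G.
    (* An empty decisive coalition would force both strict rankings of [x0] and [z0]. *)
    rewrite leqn0 cards_eq0 => /eqP -> dec0.
    have R : profile S V := [ffun=> rank_pref (fun=> 0)].
    have lt1 : ltR (f R) x0 z0 by apply: dec0 => // i; rewrite inE.
    have : ltR (f R) z0 x0 by apply: dec0 => [|i]; rewrite ?inE // eq_sym.
    by rewrite /ltR (ltRW lt1).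
  move=> leG dec; have [G0|[j Gj]] := set_0Vmem G.
    by apply: (IHn G) => //; rewrite G0 cards0.
  have [decj|decG] := decisive_split Gj dec; first by exists j.
  by apply: IHn decG; rewrite (cardsD1 j) Gj in leG.
have [|a b ab R GR|j decj] := shrink #|V| setT; first by rewrite cardsT.
  by apply: par => // i; apply: GR; rewrite inE.
exists j => x y R; have [<- _|xy] := eqVneq x y; first exact: leR_refl.
apply: contraTT => jyx; apply: decj => [|i /set1P -> //].
by rewrite eq_sym.
Qed.

End Arrow.

Section Wilson.
Variables S V : finType.
Hypothesis third : forall x y : S, exists2 z, x != z & y != z.
Variable f : swf S V.
Hypotheses (iia : IIA f) (nonimp : nonimposed f).

(** A strict ranking merged with an adjacent weak one stays strict by transitivity, so strict
    rankings are contagious. *)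
Lemma strict_nonimposed x0 y0 R0 : ltR (f R0) x0 y0 ->
  forall x y, x != y -> exists R, ltR (f R) x y.
Proof.
move=> f0.
have xy0 : x0 != y0 by apply: contraNneq f0 => ->; exact: leR_refl.
apply: (contagion third (P := fun x y => exists R, ltR (f R) x y) _ xy0); last by exists R0.
move=> x y z xy yz xz [R fR]; split.
  have [Q fQ] := nonimp y z; have [P [PR PQ]] := merge_profiles R Q xy yz xz.
  exists P; apply: (ltR_leR_trans (y := y)); first by rewrite (agree_ltR (iia PR)).
  by rewrite (iia PQ).1.
rewrite eq_sym in xz; rewrite eq_sym in yz.
have [Q fQ] := nonimp z x; have [P [PQ PR]] := merge_profiles Q R xz xy yz.
exists P; apply: (leR_ltR_trans (y := x)); last by rewrite (agree_ltR (iia PR)).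
by rewrite (iia PQ).1.
Qed.

Definition reversed (x y : S) : Prop :=
  exists2 R : profile S V, forall i, ltR (R i) x y & ltR (f R) y x.

(* One failure of the Pareto condition spreads to its full reversal. *)
Lemma pareto_failure x y (R : profile S V) :
  (forall u v, u != v -> exists Q, ltR (f Q) u v) ->
  x != y -> (forall i, ltR (R i) x y) -> leR (f R) y x ->
  forall z, y != z -> x != z -> reversed x z /\ reversed z y.
Proof.
move=> strict xy Rxy fyx z yz xz.
(* By IIA, all profiles unanimous on a strict pair get the same verdict there. *)
have eqU u v (P Q : profile S V) : (forall i, ltR (P i) u v) ->
    (forall i, ltR (Q i) u v) -> agree_on_pair (f P) (f Q) u v.
  by move=> Pu Qu; apply: iia => i; exact: ltR_agree.
have [yx zy zx] : [/\ y != x, z != y & z != x] by rewrite ![y == _]eq_sym ![z == _]eq_sym.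
split.
  have [Q fQ] := strict z y zy.
  have [P [PQ Pxy Pxz]] := unanimous_merge_profiles Q xy yz xz.
  exists P => //; apply: (ltR_leR_trans (y := y)); first by rewrite (agree_ltR (iia PQ)).
  by rewrite (eqU x y P R Pxy Rxy).2.
have [Q fQ] := strict x z xz.
have [P [PQ Pxy Pzy]] := merge_profiles_unanimous Q zx xy zy.
exists P => //; apply: (leR_ltR_trans (y := x)); last by rewrite (agree_ltR (iia PQ)).
by rewrite (eqU x y P R Pxy Rxy).2.
Qed.

Lemma IIA_rev : IIA (fun R => rev_pref (f R)).
Proof. by move=> x y P Q /iia; rewrite /agree_on_pair !leR_rev => -[]. Qed.

(** One failure of Pareto produces a reversed pair, contagion reverses every pair, and IIA extends
    each reversal to all unanimous profiles. *)
Lemma pareto_or_reversed :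
  (forall u v, u != v -> exists Q, ltR (f Q) u v) ->
  pareto f \/ pareto (fun R => rev_pref (f R)).
Proof.
move=> strict.
(* Profiles form a finite type, so a failure of Pareto can be searched for. *)
pose bad (t : S * S * profile S V) :=
  [&& t.1.1 != t.1.2, [forall i, ltR (t.2 i) t.1.1 t.1.2] & leR (f t.2) t.1.2 t.1.1].
have [[[x y] R] /and3P[/= xy /forallP Rxy fyx]|good] := pickP bad; last first.
  left=> x y R xy Rxy; apply/negP => fyx.
  by have := good (x, y, R); rewrite /bad /= xy fyx andbT => /negP; apply; apply/forallP.
right; have rev : forall a b, a != b -> reversed a b.
  have [z xz yz] := third x y.
  have [rxz _] := pareto_failure strict xy Rxy fyx yz xz.
  apply: (contagion third _ xz rxz) => u v w uv vw uw [Q Quv fQ].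
  exact: (pareto_failure strict uv Quv (ltRW fQ)).
move=> a b P ab Pab; have [Q Qab fQ] := rev _ _ ab.
rewrite /ltR leR_rev; suff /iia[-> _] : forall i, agree_on_pair (P i) (Q i) a b by [].
by move=> i; exact: ltR_agree.
Qed.

Lemma wilson : null f \/ dictatorial f.
Proof.
have [/forallP nul|] :=
  boolP [forall R : profile S V, forall x, forall y, eqR (f R) x y].
  by left=> R x y; move/forallP/(_ x)/forallP/(_ y): (nul R).
move=> /forallPn[R /forallPn[x /forallPn[y]]].
rewrite /eqR => nul; right.
have [x0 [y0 f0]] : exists x0 y0, ltR (f R) x0 y0.
  by move: nul; rewrite negb_and => /orP[]; [exists y, x | exists x, y].
have strict := strict_nonimposed f0.
have [par|par] := pareto_or_reversed strict.
  by have [j dj] := arrow third iia par x; exists j; left.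
(* A dictator of the reversed function is a dictator of the second kind for [f]. *)
have [j dj] := arrow third IIA_rev par x; exists j; right=> a b P fab.
by apply: dj; rewrite leR_rev.
Qed.

End Wilson.

(** * The cleric *)

Section Cleric.
Variables S V : finType.
Variable f : swf S V.
Hypothesis iia : IIA f.

Definition cleric_rel : rel S := fun x y => [exists R, leR (f R) x y].

Lemma cleric_total : total cleric_rel.
Proof.
move=> x y; pose R : profile S V := [ffun=> rank_pref (fun=> 0)].
by case/orP: (leR_total (f R) x y) => fR; apply/orP; [left|right]; apply/existsP; exists R.
Qed.

Lemma cleric_trans : transitive cleric_rel.
Proof.
move=> y x z cxy cyz.
have [-> //|xy] := eqVneq x y; have [<- //|yz] := eqVneq y z.
have [<-|xz] := eqVneq x z.
  by have := cleric_total x x; rewrite orbb.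
case/existsP: cxy => P fP; case/existsP: cyz => Q fQ.
have [R [RP RQ]] := merge_profiles P Q xy yz xz.
apply/existsP; exists R; apply: (leR_trans (y := y)).
  by rewrite (iia RP).1.
by rewrite (iia RQ).1.
Qed.

Definition cleric : pref S := pref_of cleric_total cleric_trans.

Lemma clerical_cleric : clerical f cleric.
Proof. by move=> x y R fR; rewrite leR_pref_of; apply/existsP; exists R. Qed.

Lemma IIA_restriction_well_defined (A : {set S}) : restriction_well_defined A f.
Proof.
by move=> R R1 R2 e1 e2 x y; apply: (iia _).1 => i; split; rewrite e1 e2.
Qed.

Lemma IIA_restrict (A : {set S}) : IIA (restrict A f).
Proof.
move=> x y P Q PQ; rewrite /agree_on_pair !leR_pref_of; apply: iia => i.
by case: (PQ i) => e1 e2; split; rewrite !extendP.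
Qed.

(** Members of a class are ranked both ways by the cleric, hence by [f] at suitable profiles on [S];
    each such profile extends its own restriction to [A]. *)
Lemma nonimposed_restrict (A : {set S}) :
  A \in equiv_classes cleric -> nonimposed (restrict A f).
Proof.
move=> /imsetP[s _ defA] x y.
have [cx cy] : eqR cleric s (val x) /\ eqR cleric s (val y).
  by have := valP x; have := valP y; rewrite /= {2 4}defA !inE.
have : leR cleric (val x) (val y).
  by case/andP: cx => _ cx; case/andP: cy => cy _; exact: leR_trans cx cy.
rewrite leR_pref_of => /existsP[R fR].
exists [ffun i => restrict_pref A (R i)].
rewrite (restrictP (R' := R)) //; first exact: IIA_restriction_well_defined.
by move=> i a b; rewrite ffunE leR_pref_of.
Qed.

End Cleric.

Lemma third_alternative (S : finType) (x y : S) :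
  2 < #|S| -> exists2 z, x != z & y != z.
Proof.
move=> S3; have [z /andP[]|none] := pickP (fun z => (x != z) && (y != z)).
  by exists z.
have : #|S| <= #|[set x; y]|.
  rewrite -cardsT; apply/subset_leq_card/subsetP => z _; have := none z.
  by rewrite !inE ![z == _]eq_sym; do 2!case: (_ == _).
by rewrite cards2 leqNgt (leq_trans _ S3) //; case: (x != y).
Qed.

Lemma restrict_cases (S V : finType) (f : swf S V) (iia : IIA f) (A : {set S}) :
  A \in equiv_classes (cleric iia) ->
  [\/ null (restrict A f), dictatorial (restrict A f) | #|A| = 2].
Proof.
move=> clA; have cardA : #|alternatives A| = #|A| by rewrite card_sig.
have [A1|A3|] := ltngtP #|A| 2; last by constructor 3.
  constructor 1 => R x y; have A1' : #|alternatives A| <= 1 by rewrite cardA.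
  by rewrite (card_le1_eqP A1' x y) // /eqR leR_refl.
have third (x y : alternatives A) : exists2 z, x != z & y != z.
  by apply: third_alternative; rewrite cardA.
have [] := wilson third (IIA_restrict iia (A := A)) (nonimposed_restrict clA).
  by constructor 1.
by constructor 2.
Qed.

(** * Deferring to the remaining voters *)

Section IndifferentVoter.
Variables S V : finType.
Variables (h : swf S V) (j : V).
Hypothesis iia : IIA h.

(** [insub] fails only at [j], so the constant rank makes [j] tie all alternatives. *)
Definition add_indifferent (R : profile S (without j)) : profile S V :=
  [ffun k => if insub k is Some k' then R k' else rank_pref (fun=> 0)].

Definition drop_voter : swf S (without j) := fun R => h (add_indifferent R).

Lemma IIA_drop_voter : IIA drop_voter.
Proof. by move=> x y P Q PQ; apply: iia => i; rewrite !ffunE; case: insub. Qed.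

Lemma defers_drop_voter : defers h drop_voter.
Proof.
move=> x y R /andP[Rxy Ryx].
suff /iia[-> _] : forall i, agree_on_pair (R i) (add_indifferent (remove_voter j R) i) x y.
  by [].
move=> i; rewrite ffunE; case: insubP => [k _ <-|]; first by rewrite ffunE.
by rewrite negbK => /eqP ->; split; rewrite leR_rank.
Qed.

End IndifferentVoter.

Theorem theorem7 (S V : finType) (f : swf S V) (hf : IIA f) :
  clerical_dictatorial f.
Proof.
(* [S] is generalized too, since the recursive call is on the alternatives of a class [A]. *)
have [n] := ubnP #|V|; elim: n S V f hf => // n IHn S V f iia leV.
apply: (CD_cleric (clerical_cleric iia)) => A clA.
split; [exact: IIA_restriction_well_defined | exact: restrict_cases clA | move=> j _].
exists (drop_voter (restrict A f) (j := j)).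
  exact/defers_drop_voter/IIA_restrict.
apply: IHn; first exact/IIA_drop_voter/IIA_restrict.
rewrite card_sig (cardC1 j) prednK //.
by apply/card_gt0P; exists j.
Qed.
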